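(* For every rooted tree $(T,r)$, the twin number $m(T,r)$ is either $1$ or infinite.
   Context: A rooted tree $(T,r)$ is a tree $T$ (possibly infinite, of arbitrary cardinality) with a distinguished vertex $r$. An embedding of a graph $G$ into a graph $H$ is an injective graph homomorphism $G\to H$ (i.e. an injective map on vertices sending edges to edges). Two rooted trees $(T,r)$ and $(T',r')$ are twins (mutually embeddable), written $(T,r)\approx(T',r')$, if there are embeddings $\phi\colon T\to T'$ and $\psi\colon T'\to T$ with $\phi(r)=r'$ and $\psi(r')=r$. They are isomorphic if there is a graph isomorphism $T\to T'$ mapping $r$ to $r'$. The twin number $m(T,r)$ is the number of isomorphism classes of rooted trees $(T',r')$ with $(T',r')\approx(T,r)$; only the distinction between natural numbers and $\infty$ (infinitely many) is made. *)

(* Defs.v *)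
From mathcomp Require Import all_boot.
From mathcomp Require Import classical_sets cardinality.

Set Implicit Arguments.
Unset Strict Implicit.
Unset Printing Implicit Defensive.

Local Open Scope classical_set_scope.

(* Vertices form a bare [Type], not an [eqType]: sets of rooted trees are used
   below, and bundling an [eqType] here would clash with the universes of
   [classical_sets]. *)
Record graph := Graph {
  vertex :> Type;
  adj : rel vertex;
  adj_sym : symmetric adj;
  adj_irr : irreflexive adj }.

Definition connected_graph (G : graph) : Prop :=
  forall x y : G, exists2 p : seq G, path (@adj G) x p & last x p = y.

(* [ordS] is the cyclic successor, so [c] runs through a cycle of length
   [n.+3] with pairwise distinct vertices. *)
Definition acyclic_graph (G : graph) : Prop :=
  forall (n : nat) (c : 'I_n.+3 -> G),
    injective c -> ~ (forall i, adj (c i) (c (ordS i))).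

Record rooted_tree := RootedTree {
  tree :> graph;
  root_vertex : tree;
  tree_connected : connected_graph tree;
  tree_acyclic : acyclic_graph tree }.

Definition embedding (G H : graph) (f : G -> H) : Prop :=
  injective f /\ {homo f : x y / adj x y}.

Definition isomorphism (G H : graph) (f : G -> H) : Prop :=
  bijective f /\ {mono f : x y / adj x y}.

Definition twins (T T' : rooted_tree) : Prop :=
  (exists2 phi : T -> T', embedding phi & phi (root_vertex T) = root_vertex T') /\
  (exists2 psi : T' -> T, embedding psi & psi (root_vertex T') = root_vertex T).

Definition isomorphic (T T' : rooted_tree) : Prop :=
  exists2 f : T -> T', isomorphism f & f (root_vertex T) = root_vertex T'.

Definition iso_class (T : rooted_tree) : set rooted_tree :=
  [set T' | isomorphic T T'].

(* The twin number of [T] is the cardinality of this set. *)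
Definition twin_classes (T : rooted_tree) : set (set rooted_tree) :=
  iso_class @` [set T' | twins T T'].

(* Main.v *)
(* A rooted tree is determined by the family of its branches at the root, so up
   to isomorphism it is an element of the coinductive type [cotree], where
   embeddability and isomorphism are simulations.

   Suppose some tree is not rigid but has finitely many twins, and choose such a
   tree [c] with the least number of twins.
   (1) Some branch of [c] is not rigid.  Otherwise, for some [s], a twin [d] of
   [c] has more branches equivalent to [s] than [c] has.  Composing embeddings
   [c -> d -> c] then yields enough infinite ascending chains of branches of [c]
   strictly above [s] to absorb all branches equivalent to [s]; so these can be
   replaced by any finite number of copies of [s], giving infinitely many twins.
   (2) Let [s] be a branch of [c] that is not rigid.  Replacing every branch
   equivalent to [s] by a twin [x] of [s] is injective in [x]; as [s] has at
   least as many twins as [c], every twin of [c] arises in this way.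
   (3) So two twins of [c] have the same branches, except for some that are
   twins of each other and, like [c], minimal counterexamples.  Repeating this
   along all levels gives an isomorphism: [c] is rigid, a contradiction. *)

Require Import Defs.
From mathcomp Require Import all_boot.
From mathcomp Require Import boolp classical_sets functions cardinality.
From Stdlib Require Eqdep.
Local Open Scope classical_set_scope.
Local Open Scope card_scope.

Set Implicit Arguments.
Unset Strict Implicit.
Unset Printing Implicit Defensive.

(** * Cardinalities *)

Lemma sval_inj (T : Type) (P : T -> Prop) : injective (@proj1_sig T P).
Proof. by move=> [x Px] [y Py] /= xy; exact: eq_exist. Qed.

Definition injects (A B : Type) : Prop := exists f : A -> B, injective f.

Lemma injects_trans A B C : injects A B -> injects B C -> injects A C.
Proof. by move=> [f fI] [g gI]; exists (g \o f); apply: inj_comp. Qed.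

Lemma injects_card A B : injects A B -> [set: A] #<= [set: B].
Proof.
move=> [f fI]; have [g] : $|{injfun [set: A] >-> [set: B]}|.
  by apply/injfunPex; exists f => // x y _ _ /fI.
exact: inj_card_le.
Qed.

Lemma injects_bijection A B : injects A B -> injects B A ->
  exists2 f : A -> B, injective f & forall b, exists a, f a = b.
Proof.
move=> /injects_card AB /injects_card BA.
have /card_eqVP[f] := Cantor_Bernstein AB BA.
exists (fun a => val (f (SigSub (mem_set (I : [set: A] a))))).
  by move=> x y /val_inj/(in2TT 'inj_f) [].
move=> b; pose b' := SigSub (mem_set (I : [set: B] b)).
have [[a aT] _ ab] := 'surj_f (I : [set: [set: B]] b').
exists a; have -> : b = val b' by []; rewrite -ab.
by congr (val (f _)); exact: val_inj.
Qed.

Definition finitely_many (A : Type) : Prop := exists n, injects A 'I_n.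

Lemma not_finitely_many A : ~ finitely_many A -> injects nat A.
Proof.
move=> fA; have /infiniteP/card_leP[f] : infinite_set [set: A].
  move=> [n /card_eqVP[f]]; apply: fA; exists n.
  exists (fun a => let m := f (SigSub (mem_set (I : [set: A] a))) in
    Ordinal (set_mem (valP m))).
  by move=> x y /(congr1 val)/= /val_inj/(in2TT 'inj_f) [].
exists (fun n => val (f (SigSub (mem_set (I : [set: nat] n))))).
by move=> x y /val_inj/(in2TT 'inj_f) [].
Qed.

(** A maximal disjoint family of pairs [{inl a, inr b}] is a maximal partial injection; by
    maximality it exhausts [A] or [B]. *)
Lemma injects_total A B : injects A B \/ injects B A.
Proof.
pose F (p : A * B) : set (A + B) := [set inl p.1; inr p.2].
have [E [_ Etriv Emax]] := ex_maximal_disjoint_subcollection F setT.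
have [AE|/existsNP[a naE]] := pselect (forall a, exists b, E (a, b)).
  left; have [f fE] := choice AE; exists f => x y fxy.
  suff : (x, f x) = (y, f y) by case.
  by apply: Etriv => //; exists (inr (f x)); split; right; rewrite //= fxy.
have [BE|/existsNP[b nbE]] := pselect (forall b, exists a, E (a, b)).
  right; have [f fE] := choice BE; exists f => x y fxy.
  suff : (f x, x) = (f y, y) by case.
  by apply: Etriv => //; exists (inl (f x)); split; left; rewrite //= fxy.
exfalso; apply: (Emax (E `|` [set (a, b)])) => //.
  split; first by move=> p; left.
  by move=> /(_ (a, b) (or_intror erefl)) Eab; apply: naE; exists b.
have no p : E p -> ~ (F p `&` F (a, b) !=set0).
  case: p => x y Exy [z [[->|->] [|]]] //= [e]; subst.
  - by apply: naE; exists y.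
  - by apply: nbE; exists x.
move=> p q [Ep|->] [Eq|->] //; first exact: Etriv.
- by move=> /(no _ Ep).
- by rewrite setIC => /(no _ Eq).
Qed.

(** Take a maximal disjoint family [E] of injective sequences in [A]. By maximality only a finite
    set [U] is left uncovered, so [A] is [E * nat] plus finitely many points, and each copy of [nat]
    can be doubled. *)
Lemma injects_sum_self A : ~ finitely_many A -> injects (A + A) A.
Proof.
move=> fA.
have [E [Einj Etriv Emax]] := ex_maximal_disjoint_subcollection
  (fun f : nat -> A => range f) [set f | injective f].
pose U := {a : A | ~ exists2 f, E f & range f a}.
have [m [j jI]] : finitely_many U.
  apply: contrapT => /not_finitely_many[u uI].
  pose v n := sval (u n).
  have vI : injective v by move=> x y /sval_inj/uI.
  have nvE f n : E f -> ~ range f (v n).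
    by move=> Ef vf; case: (svalP (u n)); exists f.
  apply: (Emax (E `|` [set v])).
  - split; first by move=> p; left.
    by move=> /(_ v (or_intror erefl)) Ev; apply: (nvE v 0) => //; exists 0.
  - by move=> f [/Einj|->].
  have no f : E f -> ~ (range f `&` range v !=set0).
    by move=> Ef [_ [[x _ <-] [n _ nx]]]; apply: (nvE f n Ef); exists x.
  move=> f g [Ef|->] [Eg|->] //; first exact: Etriv.
  - by move=> /(no _ Ef).
  - by rewrite setIC => /(no _ Eg).
have [e Ee] : exists e, E e.
  apply: contrapT => /forallNP nE; apply: fA; exists m.
  have uP a : ~ exists2 f, E f & range f a by move=> [f /nE].
  by exists (fun a => j (exist _ a (uP a))) => x y /jI [].
have key (a : A) : exists x : (nat -> A) * nat + U,
    match x with inl p => E p.1 /\ p.1 p.2 = a | inr u => sval u = a end.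
  have [[f Ef [n _ fn]]|nEa] := pselect (exists2 f, E f & range f a).
    by exists (inl (f, n)).
  by exists (inr (exist _ a nEa)).
have [c cP] := choice key.
have cI : injective c.
  move=> x y cxy; move: (cP x) (cP y); rewrite cxy.
  by case: (c y) => [p [_ <-] [_ <-]|u <- <-].
have EI f g n k : E f -> E g -> f n = g k -> f = g /\ n = k.
  move=> Ef Eg fg; have fgE : f = g.
    by apply: Etriv => //; exists (f n); split; [exists n|rewrite fg; exists k].
  by subst g; split=> //; exact: (Einj _ Ef).
(* The exceptional points in [U], at most [m], go to the first [2m] places of
   the sequence [e]; all the sequences are shifted by [2m] to make room. *)
pose enc (b : bool) (a : A) := match c a with
  | inl p => (p.1, ((p.2 + m).*2 + b)%N)
  | inr u => (e, ((j u).*2 + b)%N)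
  end.
have encE b a : E (enc b a).1 by rewrite /enc; have := cP a; case: (c a) => [p []|].
have encI b b' a a' : enc b a = enc b' a' -> b = b' /\ a = a'.
  have parity (n n' : nat) : n.*2 + b = n'.*2 + b' -> b = b' /\ n = n'.
    move=> nn; have bb : b = b'.
      by have /(congr1 odd) := nn; rewrite !oddD !odd_double; case: (b) (b') => [] [].
    split=> //; move: nn; rewrite bb => /addIn /(congr1 half).
    by rewrite !doubleK.
  move=> ee; suff : b = b' /\ c a = c a' by move=> [-> /cI ->].
  move: ee; rewrite /enc; case: (c a) (c a') => [[f n]|u] [[g k]|w] /= [].
  - by move=> -> /parity [-> /addIn ->].
  - move=> _ /parity [_ ju]; have := ltn_ord (j w); rewrite -ju.
    by rewrite ltnNge leq_addl.
  - move=> _ /parity [_ ju]; have := ltn_ord (j u); rewrite ju.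
    by rewrite ltnNge leq_addl.
  - by move=> /parity [-> /val_inj/jI ->].
pose dec (p : (nat -> A) * nat) := p.1 p.2.
have decI b b' a a' : dec (enc b a) = dec (enc b' a') -> b = b' /\ a = a'.
  move=> /EI [] // e1 e2; apply: encI.
  by rewrite [LHS]surjective_pairing e1 e2 -surjective_pairing.
exists (fun s => match s with
  | inl a => dec (enc false a)
  | inr a => dec (enc true a) end).
by move=> [x|x] [y|y] /decI [] // _ ->.
Qed.

(** Otherwise [B] injects into [A] by comparability, and then [B + C] injects into [A + A], hence
    into [A]. *)
Lemma injects_complement A B C : ~ finitely_many A -> injects C A ->
  ~ injects (B + C) A -> injects A B.
Proof.
move=> /injects_sum_self AA [g gI] nBC; case: (injects_total A B) => // -[f fI].
case: nBC; apply: injects_trans AA.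
exists (fun s => match s with inl b => inl (f b) | inr c => inr (g c) end).
by move=> [x|x] [y|y] // [] => [/fI|/gI] ->.
Qed.

(** * Twins of coinductive trees *)

CoInductive cotree : Type := Node (J : Type) of J -> cotree.

Definition idx (c : cotree) : Type := let: Node J _ := c in J.

Definition br (c : cotree) : idx c -> cotree :=
  match c with Node _ f => f end.

Definition sim_step (full : Prop) (R : cotree -> cotree -> Prop) c d : Prop :=
  exists s : idx c -> idx d,
    [/\ injective s, full -> forall j, exists i, s i = j
      & forall i, R (br i) (br (s i))].

(* [sim False] is root-preserving embeddability, [sim True] is isomorphism. *)
CoInductive sim (full : Prop) (c d : cotree) : Prop :=
  Sim (s : idx c -> idx d) of injective s &
    full -> forall j, exists i, s i = j & forall i, sim full (br i) (br (s i)).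

Lemma sim_unfold full c d : sim full c d -> sim_step full (sim full) c d.
Proof. by case=> s sI sS sR; exists s. Qed.

Lemma sim_coind full (R : cotree -> cotree -> Prop) :
  (forall c d, R c d -> sim_step full R c d) ->
  forall c d, R c d -> sim full c d.
Proof.
move=> Rstep; cofix sim_coind => c d /Rstep [s [sI sS sR]].
exact: (Sim sI sS (fun i => sim_coind _ _ (sR i))).
Qed.

Lemma sim_refl full c : sim full c c.
Proof.
apply: (@sim_coind _ eq) => // {}c _ <-.
by exists id; split=> // _ j; exists j.
Qed.

Lemma sim_trans full b c d : sim full b c -> sim full c d -> sim full b d.
Proof.
move=> bc cd; apply: (@sim_coind _ (fun b d => exists2 c, sim full b c & sim full c d));
  last by exists c.
move=> {bc cd} {}b {}d [{}c /sim_unfold[s [sI sS sR]] /sim_unfold[t [tI tS tR]]].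
exists (t \o s); split; first exact: inj_comp.
  by move=> f j; have [k <-] := tS f j; have [i <-] := sS f k; exists i.
by move=> i; exists (br (s i)).
Qed.

Notation cemb := (sim False).
Notation ciso := (sim True).

Lemma ciso_cemb c d : ciso c d -> cemb c d.
Proof.
apply: sim_coind => {}c {}d /sim_unfold[s [sI _ sR]].
by exists s.
Qed.

Lemma ciso_sym c d : ciso c d -> ciso d c.
Proof.
move=> cd; apply: (@sim_coind _ (fun d c => ciso c d)) => // {cd} {}d {}c.
move=> /sim_unfold[s [sI /(_ I) sS sR]].
have [t st] := choice sS; exists t; split.
- by move=> x y txy; rewrite -(st x) txy st.
- by move=> _ i; exists (s i); apply: sI; rewrite st.
- by move=> j; rewrite -{2}(st j).
Qed.

Definition twin (c d : cotree) : Prop := cemb c d /\ cemb d c.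

Lemma twin_refl c : twin c c. Proof. by split; exact: sim_refl. Qed.

Lemma twin_sym c d : twin c d -> twin d c. Proof. by case. Qed.

Lemma twin_trans b c d : twin b c -> twin c d -> twin b d.
Proof. by move=> [bc cb] [cd dc]; split; [exact: sim_trans cd|exact: sim_trans cb]. Qed.

Lemma ciso_twin c d : ciso c d -> twin c d.
Proof. by move=> cd; split; apply: ciso_cemb => //; exact: ciso_sym. Qed.

Definition rigid (c : cotree) : Prop := forall d, twin c d -> ciso c d.

(** The pigeonhole form counts twins up to isomorphism without forming a quotient. *)
Definition at_most_twins (n : nat) (c : cotree) : Prop :=
  forall x : 'I_n.+1 -> cotree, (forall i, twin c (x i)) ->
  exists i j, i <> j /\ ciso (x i) (x j).

Lemma at_most_twins_twin n c d :
  twin c d -> at_most_twins n c -> at_most_twins n d.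
Proof. by move=> cd cn x dx; apply: cn => i; exact: twin_trans cd _. Qed.

Definition replace (c s x : cotree) : cotree :=
  Node (fun k : idx c => if `[<twin s (br k)>] then x else br k).

Lemma twin_replace c s x : twin s x -> twin c (replace c s x).
Proof.
move=> sx; have step (k : idx c) : twin (br k) (@br (replace c s x) k).
  rewrite /=; case: asboolP => [sk|_]; last exact: twin_refl.
  exact: twin_trans (twin_sym sk) sx.
split.
  by apply: (@Sim False c (replace c s x) id) => // k; case: (step k).
by apply: (@Sim False (replace c s x) c id) => // k; case: (step k).
Qed.

(** An isomorphism sends the branch at [k], now [x], to a twin of [s]. The untouched branches are
    not twins of [s], so the image is [y]. *)
Lemma replace_inj c s x y (k : idx c) : twin s (br k) -> twin s x -> twin s y ->
  ciso (replace c s x) (replace c s y) -> ciso x y.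
Proof.
move=> sk sx sy /sim_unfold[f [_ _ /(_ k)]] /=.
case: asboolP => // _; case: asboolP => // nsfk xfk.
by case: nsfk; apply: twin_trans sx (ciso_twin xfk).
Qed.

Lemma at_most_twins_br n c (k : idx c) :
  at_most_twins n c -> at_most_twins n (br k).
Proof.
move=> cn x kx; have [i|i [j [ij xij]]] := cn (fun i => replace c (br k) (x i)).
  exact: twin_replace.
by exists i, j; split=> //; exact: replace_inj (twin_refl _) _ _ xij.
Qed.

(** * Absorbing branches into infinite ascending chains *)

Section ascending_chains.
Variables (c d s : cotree).
Hypothesis cd : twin c d.

Let K := {k : idx c | twin s (br k)}.
Let K' := {k : idx d | twin s (br k)}.
Let W := {w : idx c | ~ twin s (br w)}.

(** As in Hilbert's hotel, the branches outside the class of [s] make room among themselves for [X]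
    many copies of [s]. *)
Let absorbs (X : Type) : Prop := exists t : W + X -> W,
  [/\ injective t, forall w, cemb (br (sval w)) (br (sval (t (inl w))))
    & forall x, cemb s (br (sval (t (inr x))))].

Let absorbs_inj X Y : injects X Y -> absorbs Y -> absorbs X.
Proof.
move=> [f fI] [t [tI tW tY]].
exists (fun z => match z with inl w => t (inl w) | inr x => t (inr (f x)) end).
split=> //; by move=> [u|u] [v|v] // /tI [] // => [->|/fI ->].
Qed.

Let absorbs_sum X Y : absorbs X -> absorbs Y -> absorbs (X + Y).
Proof.
move=> [t [tI tW tX]] [u [uI uW uY]].
exists (fun z => match z with
  | inl w => u (inl (t (inl w)))
  | inr (inl x) => u (inl (t (inr x)))
  | inr (inr y) => u (inr y) end); split.
- by move=> [v|[v|v]] [w|[w|w]] // /uI [] // => [/tI [] ->|/tI|/tI|/tI [] ->|->].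
- by move=> w; apply: sim_trans (uW _).
- by move=> [x|y] //; apply: sim_trans (uW _).
Qed.

Section maps.
Variables (f : idx c -> idx d) (g : idx d -> idx c).
Hypotheses (fI : injective f) (gI : injective g).
Hypothesis fR : forall i, cemb (br i) (br (f i)).
Hypothesis gR : forall i, cemb (br i) (br (g i)).

Let P := {p : idx d | twin s (br p) /\ ~ twin s (br (g p))}.
Let Q := {p : idx d | twin s (br p) /\ twin s (br (g p))}.

Let h := g \o f.

(* For [p : P] the chain [g p <= h (g p) <= h (h (g p)) <= ...] stays strictly
   above [s]; the chains of distinct [p] are disjoint, so each of them can be
   shifted by one place to make room for one more branch. *)
Let on_chain (w : idx c) : Prop := exists (p : P) n, w = iter n h (g (sval p)).

Let chain_above w : on_chain w -> cemb s (br w) /\ ~ twin s (br w).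
Proof.
move=> [[p [sp nsgp]] [n ->]] /=; elim: n => [|n [IH1 IH2]] /=.
  by split=> //; apply: sim_trans (gR _); case: sp.
have hR : cemb (br (iter n h (g p))) (br (h (iter n h (g p)))).
  by apply: sim_trans (gR _); exact: fR.
split; first exact: sim_trans hR.
by move=> [_ hs]; apply: IH2; split=> //; exact: sim_trans hs.
Qed.

Let absorbs_P : absorbs P.
Proof.
pose t0 (w : idx c) := if `[<on_chain w>] then h w else w.
have chain_h w : on_chain w -> on_chain (h w).
  by move=> [p [n ->]]; exists p, n.+1.
have gP (p : P) : ~ twin s (br (g (sval p))) by case: p => p [].
have t0P (w : W) : ~ twin s (br (t0 (sval w))).
  rewrite /t0; case: asboolP => [/chain_h/chain_above[]//|_]; exact: (svalP w).
(* A chain starts at a point freed by the shift: [g p = h w] would give [p = f w], placing [w]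
   between [s] and a twin of [s]. *)
have gp_h (p : P) (w : idx c) : on_chain w -> g (sval p) <> h w.
  move=> /chain_above[sw nsw] /gI pw; apply: nsw; split=> //.
  apply: sim_trans (fR _) _; rewrite -pw.
  by case: p {pw} => p [[]].
have t0I : injective t0.
  move=> v w; rewrite /t0; case: asboolP => [cv|ncv]; case: asboolP => [cw|ncw] //.
  - by move=> /gI/fI.
  - by move=> vw; case: ncw; rewrite -vw; exact: chain_h.
  - by move=> vw; case: ncv; rewrite vw; exact: chain_h.
have gp_t0 (p : P) (w : W) : g (sval p) <> t0 (sval w).
  rewrite /t0; case: asboolP => [/gp_h //|ncw pw].
  by apply: ncw; exists p, 0%N.
exists (fun z => match z with
  | inl w => exist _ (t0 (sval w)) (t0P w)
  | inr p => exist _ (g (sval p)) (gP p) end); split.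
- move=> [u|u] [v|v] /(congr1 sval) /=.
  + by move=> /t0I/sval_inj ->.
  + by move=> /esym/gp_t0.
  + by move=> /gp_t0.
  + by move=> /gI/sval_inj ->.
- move=> w /=; rewrite /t0; case: asboolP => _; last exact: sim_refl.
  by apply: sim_trans (gR _); exact: fR.
- move=> [p [[sp _] _]] /=; exact: sim_trans sp (gR _).
Qed.

Hypothesis nKK : ~ injects K' K.

(** If [P] were empty, [g] would restrict to an injection of [K'] into [K]. *)
Let P_inhabited : injects unit P.
Proof.
have [[p Pp]|/forallNP nP] := pselect (exists p, twin s (br p) /\ ~ twin s (br (g p))).
  by exists (fun=> exist _ p Pp) => -[] [].
case: nKK; have gK (k : K') : twin s (br (g (sval k))).
  by apply: contrapT => nk; apply: (nP (sval k)); split=> //; exact: (svalP k).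
exists (fun k => exist _ (g (sval k)) (gK k)) => x y /(congr1 sval)/=.
by move=> /gI/sval_inj.
Qed.

(** A single chain makes room for one copy of [s]; shifting it [n] times makes room for [n]. *)
Let absorbs_ord n : absorbs 'I_n.
Proof.
elim: n => [|n IH].
  exists (fun z : W + 'I_0 => match z with
    | inl w => w
    | inr i => False_rect _ (notF (valP i)) end).
  split=> [[x|[]]// [y|[]]//|w|[]//]; first by move=> ->.
  exact: sim_refl.
apply: absorbs_inj (absorbs_sum IH (absorbs_inj P_inhabited absorbs_P)).
exists (fun i => if unlift ord_max i is Some j then inl j else inr tt).
move=> i j; case: unliftP => [i' ->|->]; case: unliftP => [j' ->|->] //.
by case=> ->.
Qed.

(** For infinite [K], the chains are numerous enough: [K'] injects into [P + Q] but not into [K],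
    while [Q] injects into [K] through [g]. Hence [K] injects into [P]. *)
Let absorbs_K : absorbs K.
Proof.
have [[n Kn]|fK] := pselect (finitely_many K).
  exact: absorbs_inj Kn (absorbs_ord n).
apply: absorbs_inj absorbs_P; apply: (@injects_complement _ P Q) => //.
  have qK (q : Q) : twin s (br (g (sval q))) by case: q => q [].
  exists (fun q => exist _ (g (sval q)) (qK q)) => x y /(congr1 sval)/=.
  by move=> /gI/sval_inj.
move=> PQ; apply: nKK; apply: (injects_trans (B := P + Q)) PQ.
have key (k : K') : exists z : P + Q,
    sval k = match z with inl p => sval p | inr q => sval q end.
  case: k => k sk; have [gk|gk] := pselect (twin s (br (g k))).
    by exists (inr (exist _ k (conj sk gk))).
  by exists (inl (exist _ k (conj sk gk))).
have [z zP] := choice key; exists z => x y xy.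
by apply: sval_inj; rewrite zP xy -zP.
Qed.

(* ['I_n] would force the index universe of [cotree] above that of [eqType],
   hence strictly above that of the vertices of a graph. *)
Let below (n : nat) := {i : nat | i < n}.

Let ord_below n (i : below n) : 'I_n := Ordinal (svalP i).

Let ord_below_inj n : injective (@ord_below n).
Proof. by move=> i j [] /sval_inj. Qed.

Let add_copies n : cotree :=
  Node (fun z : W + below n => match z with inl w => br (sval w) | inr _ => s end).

(** Towards [add_copies n], the whole class of [s] is absorbed by [W] and no added copy is hit;
    backwards, [W] absorbs the [n] copies. *)
Let twin_add_copies n : twin c (add_copies n).
Proof.
split.
  have [t [tI tW tK]] := absorbs_K.
  have key (k : idx c) : exists z : W + K,
      k = match z with inl w => sval w | inr k => sval k end.
    have [sk|nsk] := pselect (twin s (br k)).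
      by exists (inr (exist _ k sk)).
    by exists (inl (exist _ k nsk)).
  have [u uP] := choice key.
  apply: (@Sim False c (add_copies n) (fun k => inl (t (u k)))) => //.
    by move=> x y [] /tI xy; rewrite (uP x) xy -uP.
  move=> k /=; rewrite {1}(uP k); case: (u k) => [w|[l [sl ls]]]; first exact: tW.
  exact: sim_trans ls (tK _).
have [|t [tI tW tK]] := @absorbs_inj (below n) 'I_n _ (absorbs_ord n).
  by exists (@ord_below n); exact: ord_below_inj.
apply: (@Sim False (add_copies n) c (fun z => sval (t z))) => //.
  by move=> x y /sval_inj/tI.
by move=> [w|i] /=; [exact: tW|exact: tK].
Qed.

(** Branches indexed by [W] are not twins of [s], so an isomorphism sends copies of [s] to copies of
    [s]. *)
Let add_copies_le n m : ciso (add_copies n) (add_copies m) -> n <= m.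
Proof.
move=> /sim_unfold[/= t [tI _ tR]].
have key (i : 'I_n) : exists j : below m, t (inr (exist _ (val i) (valP i))) = inr j.
  move: (exist _ _ _) => {}i.
  have := tR (inr i); case: (t (inr i)) => [[w nsw] /= /ciso_twin //|j _].
  by exists j.
have [u uP] := choice key.
have uI : injective (@ord_below m \o u).
  move=> x y /ord_below_inj xy; apply: val_inj.
  by have := uP x; rewrite xy -uP => /tI [].
by have := leq_card _ uI; rewrite !card_ord.
Qed.

Lemma many_twins_maps n : ~ at_most_twins n c.
Proof.
move=> cn; have [i|i [j [ij iso]]] := cn (fun i => add_copies i).
  exact: twin_add_copies.
apply: ij; apply: val_inj; apply/eqP; rewrite eqn_leq.
by rewrite (add_copies_le iso) (add_copies_le (ciso_sym iso)).
Qed.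

End maps.

Lemma many_twins n : ~ injects K' K -> ~ at_most_twins n c.
Proof.
case: cd => /sim_unfold[f [fI _ fR]] /sim_unfold[g [gI _ gR]].
by move=> nKK; exact: (many_twins_maps fI gI fR gR nKK).
Qed.

End ascending_chains.

(** By [many_twins], every twin class of branches injects from [c] to [d] and back. Cantor-Bernstein
    bijections, one per class, glue to a bijection of all branches, and matched twins are isomorphic
    by rigidity. *)
Lemma rigid_branches n c : at_most_twins n c ->
  (forall k : idx c, rigid (br k)) -> rigid c.
Proof.
move=> cn krigid d cd; have dn := at_most_twins_twin cd cn.
have inj s : injects {k : idx d | twin s (br k)} {k : idx c | twin s (br k)}.
  by apply: contrapT => /(many_twins cd) /(_ cn).
have inj' s : injects {k : idx c | twin s (br k)} {k : idx d | twin s (br k)}.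
  by apply: contrapT => /(many_twins (twin_sym cd)) /(_ dn).
(* Indexing by the class [C] instead of a representative [s] makes the chosen matching the same for
   all branches of one class. A predicate that is not a twin class gets an arbitrary relation. *)
have match_class (C : cotree -> Prop) : exists G : idx c -> idx d -> Prop,
    forall s, C = twin s ->
    [/\ forall k, C (br k) -> exists k', G k k',
        forall k', C (br k') -> exists k, G k k',
        forall k k', G k k' -> C (br k) /\ C (br k'),
        forall k k' l', G k k' -> G k l' -> k' = l'
      & forall k l k', G k k' -> G l k' -> k = l].
  have [[s ->]|/forallNP nC] := pselect (exists s, C = twin s); last first.
    by exists (fun _ _ => True) => s /nC.
  have [f fI fS] := injects_bijection (inj' s) (inj s).
  exists (fun k k' => exists x, sval x = k /\ sval (f x) = k') => _ _; split.
  - by move=> k sk; exists (sval (f (exist _ k sk))), (exist _ k sk).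
  - move=> k' sk'; have [x fx] := fS (exist _ k' sk').
    by exists (sval x), x; rewrite fx.
  - by move=> k k' [x [<- <-]]; split; [exact: (svalP x)|exact: (svalP (f x))].
  - by move=> k k' l' [x [<- <-]] [y [/sval_inj <- <-]].
  - by move=> k l k' [x [<- <-]] [y [<-]] /sval_inj/fI ->.
have [G GP] := choice match_class.
have classE s t : twin s t -> twin s = twin t.
  move=> st; apply/funext => u; apply/propext; split.
    exact: twin_trans (twin_sym st).
  exact: twin_trans.
have key (k : idx c) : exists k', G (twin (br k)) k k'.
  have [+ _ _ _ _] := GP (twin (br k)) (br k) erefl.
  by apply; exact: twin_refl.
have [f fP] := choice key.
have twin_f k : twin (br k) (br (f k)).
  by have [_ _ + _ _] := GP (twin (br k)) (br k) erefl => /(_ _ _ (fP k)) [].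
apply: (@Sim True c d f).
- move=> k l kl; have [_ _ _ _ +] := GP (twin (br k)) (br k) erefl.
  apply; first exact: fP.
  rewrite kl (classE _ (br l)) //; apply: twin_trans (twin_f k) _.
  by rewrite kl; exact: twin_sym.
- move=> _ k'; have [_ + _ _ _] := GP (twin (br k')) (br k') erefl.
  move=> /(_ k' (twin_refl _)) [k Gk]; exists k.
  have [_ _ + _ _] := GP (twin (br k')) (br k') erefl => /(_ _ _ Gk) [k'k _].
  have [_ _ _ + _] := GP (twin (br k')) (br k') erefl.
  move=> /(_ _ _ _ _ Gk); apply; rewrite (classE _ _ k'k); exact: fP.
- by move=> k; apply: krigid.
Qed.

(** * Minimal counterexamples *)

Lemma rigid_twin c d : twin c d -> rigid c -> rigid d.
Proof.
move=> cd crigid e de; apply: sim_trans (ciso_sym (crigid d cd)) _.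
exact: crigid (twin_trans cd de).
Qed.

Lemma rigid_or_many_twins c : rigid c \/ forall n, ~ at_most_twins n c.
Proof.
pose bad n c := at_most_twins n c /\ ~ rigid c.
suff nbad n d : ~ bad n d.
  have [?|crigid] := pselect (rigid c); [by left|right => n cn].
  by apply: (nbad n c).
move: d => d0 bad0.
have exbad : exists n, `[<exists c, bad n c>] by exists n; apply/asboolP; exists d0.
case: (ex_minnP exbad) => -[|N] /asboolP[{}c [cN nrigid]] Nmin.
  (* The least bound is not [0]: the constant family [c] over ['I_1] has no two distinct indices. *)
  have [i|i [j [ij _]]] := cN (fun=> c); first exact: twin_refl.
  by apply: ij; rewrite (ord1 i) (ord1 j).
have bad_twin u v : twin u v -> bad N.+1 u -> bad N.+1 v.
  move=> uv [uN nu]; split; first exact: at_most_twins_twin uv uN.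
  by move=> /(rigid_twin (twin_sym uv)).
(* By minimality of [N] the non-rigid branch [s] of [u] has at least as many
   twins as [u] itself, hence replacing [s] produces all twins of [u]. *)
have all_twins u : bad N.+1 u -> exists s, bad N.+1 s /\
    forall d, twin u d -> exists2 x, twin s x & ciso d (replace u s x).
  move=> [uN nu].
  have [k nk] : exists k : idx u, ~ rigid (br k).
    by apply/existsNP => /(rigid_branches uN).
  have kN := at_most_twins_br (k := k) uN.
  exists (br k); split=> // d ud.
  have : ~ at_most_twins N (br k).
    move=> kN'; suff : N < N by rewrite ltnn.
    by apply: Nmin; apply/asboolP; exists (br k).
  move=> /existsNP[x /not_implyP[kx xN]].
  (* The [N.+1] pairwise non-isomorphic replacements together with [d] are one twin too many, so [d]
     is isomorphic to a replacement. *)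
  pose y (i : 'I_N.+2) :=
    if unlift ord0 i is Some j then replace u (br k) (x j) else d.
  have uy i : twin u (y i).
    by rewrite /y; case: unliftP => [j _|_] //; exact: twin_replace.
  have [i [j [ij]]] := uN y uy.
  rewrite /y; case: unliftP => [i' ei|ei]; case: unliftP => [j' ej|ej].
  - move=> /(replace_inj (twin_refl _) (kx i') (kx j')) xij.
    case: xN; exists i', j'; split=> // e.
    by apply: ij; rewrite ei ej e.
  - by move=> /ciso_sym di; exists (x i'); first exact: kx.
  - by move=> dj; exists (x j'); first exact: kx.
  - by case: ij; rewrite ei ej.
apply: (nrigid) => d cd.
apply: (@sim_coind _ (fun u v => ciso u v \/ twin u v /\ bad N.+1 u));
  last by right; split.
move=> u v [/sim_unfold[f [fI fS fR]]|[uv ubad]].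
  by exists f; split=> // i; left.
have [s [sbad all_u]] := all_twins u ubad.
(* Both [u] and [v] are presented as replacements in the same [u] at the same [s]. These share their
   index type and differ only where one has [x] and the other [y]. *)
have [x sx /sim_unfold[f [fI /(_ Logic.I) fS fR]]] := all_u u (twin_refl u).
have [y sy /ciso_sym/sim_unfold[g [gI /(_ Logic.I) gS gR]]] := all_u v uv.
exists (g \o f : idx u -> idx v); split.
- exact: inj_comp.
- by move=> _ j; have [k <-] := gS j; have [i <-] := fS k; exists i.
- move=> i; have := fR i; have /= := gR (f i).
  case: asboolP => [sfi yj ix|nsfi fij ifi]; last by left; exact: sim_trans ifi fij.
  right; have si := twin_trans sx (twin_sym (ciso_twin ix)).
  split; last exact: bad_twin si sbad.
  exact: twin_trans (twin_sym si) (twin_trans sy (ciso_twin yj)).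
Qed.

(** * Levels of a rooted tree *)

(** Depth and parent functions; [p] is unconstrained at the root. *)
Definition levels (T : rooted_tree) (d : T -> nat) (p : T -> T) : Prop :=
  [/\ d (root_vertex T) = 0, forall v, d v = 0 -> v = root_vertex T,
      forall v n, d v = n.+1 -> adj (p v) v /\ d (p v) = n
    & forall u v, adj u v ->
      d v = (d u).+1 /\ p v = u \/ d u = (d v).+1 /\ p u = v].

Section cycles.
Variable G : graph.

(** Vertices form a bare type, so [pairwise neq] with a classically decided [neq] expresses that a
    list has no repetition. *)
Let neq (x y : G) : bool := `[<x <> y>].

Lemma acyclic_cycle x y z (s : seq G) : acyclic_graph G ->
  pairwise neq (x :: y :: z :: s) -> path (@adj G) x (y :: z :: rcons s x) -> False.
Proof.
move=> /(_ (size s) (fun i => nth x (x :: y :: z :: s) i)) acyc.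
move=> /(pairwiseP x) distinct /(pathP x) adjacent; apply: acyc.
  have lt_neq (i j : 'I_(size s).+3) : i < j ->
      nth x (x :: y :: z :: s) i <> nth x (x :: y :: z :: s) j.
    move=> ij; apply/asboolP; apply: distinct => //; exact: ltn_ord.
  move=> i j eij; apply: val_inj => /=; case: (ltngtP i j) => //.
    by move=> /lt_neq.
  by move=> /lt_neq /(_ (esym eij)).
move=> i; have iN : i < size (y :: z :: rcons s x) by rewrite /= size_rcons.
suff -> : nth x (x :: y :: z :: s) (ordS i) = nth x (y :: z :: rcons s x) i.
  have := adjacent i iN; congr adj.
  by rewrite -!rcons_cons nth_rcons (ltn_ord i).
rewrite /= -!rcons_cons nth_rcons /=.
have := ltn_ord i; rewrite ltnS leq_eqVlt => /orP[/eqP -> | iN'].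
  by rewrite modnn ltnn eqxx.
by rewrite modn_small // iN'.
Qed.

End cycles.

Section levels_exist.
Variable T : rooted_tree.

Let r := root_vertex T.
Let reach n (v : T) : Prop :=
  exists s, [/\ path (@adj T) r s, last r s = v & size s = n].

(** [d] is the distance to the root and [p] picks a neighbour closer to it; acyclicity rules out
    edges within a level and second parents. *)
Lemma levels_exist : exists dp : (T -> nat) * (T -> T), levels dp.1 dp.2.
Proof.
have ex_reach v : exists n, `[<reach n v>].
  by have [s ps ls] := tree_connected r v; exists (size s); apply/asboolP; exists s.
pose d v := ex_minn (ex_reach v).
have dP v : reach (d v) v by rewrite /d; case: ex_minnP => n /asboolP.
have dmin n v : reach n v -> d v <= n.
  by rewrite /d; case: ex_minnP => m _ mmin vn; apply: mmin; apply/asboolP.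
have reachS n u v : adj u v -> reach n u -> reach n.+1 v.
  move=> uv [s [ps ls <-]]; exists (rcons s v).
  by rewrite rcons_path ps ls uv last_rcons size_rcons.
have d_adj u v : adj u v -> d v <= (d u).+1.
  by move=> uv; apply: dmin; exact: reachS uv (dP u).
have d0 v : d v = 0 -> v = r.
  by move=> dv; have := dP v; rewrite dv => -[s [_ <- /size0nil ->]].
have dr : d r = 0.
  by apply/eqP; rewrite -leqn0; apply: dmin; exists [::].
have ex_parent v : exists u, forall n, d v = n.+1 -> adj u v /\ d u = n.
  have [->|] := eqVneq (d v) 0; first by exists v.
  have [s] := dP v; case: (lastP s) => [[_ _ <-]//|{}s w].
  rewrite rcons_path last_rcons size_rcons => -[/andP[ps uw] wv sd] _.
  rewrite wv in uw; exists (last r s) => n dv; split=> //.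
  apply/eqP; rewrite eqn_leq; apply/andP; split.
    by apply: dmin; exists s; split=> //; apply/eqP; rewrite -eqSS sd dv.
  by rewrite -ltnS -dv; exact: d_adj.
have [p pP] := choice ex_parent.
pose neq (x y : T) : bool := `[<x <> y>].
have d_neq x y : d x < d y -> neq x y.
  by move=> xy; apply/asboolP => e; rewrite e ltnn in xy.
have neqC x y : neq x y = neq y x.
  by apply/idP/idP => /asboolP h; apply/asboolP => /esym.
(* Following parents from [x] and [y] until they meet gives a path whose interior lies at smaller
   depth. *)
have connect n : forall x y, x <> y -> d x = n -> d y = n -> exists z s,
    [/\ path (@adj T) x (rcons (z :: s) y), all (fun u => d u < n) (z :: s)
      & pairwise neq (z :: s)].
  elim: n => [|n IH] x y xy dx dy; first by case: xy; rewrite (d0 _ dx) (d0 _ dy).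
  have [[ax pdx] [ay pdy]] := (pP x n dx, pP y n dy).
  have [pxy|pxy] := pselect (p x = p y).
    exists (p x), [::]; split; last by [].
      by rewrite /= adj_sym ax pxy ay.
    by rewrite /= pdx leqnn.
  have [z [s [ps sn sneq]]] := IH _ _ pxy pdx pdy.
  exists (p x), (rcons (z :: s) (p y)); split.
  - rewrite rcons_path last_cons last_rcons ay andbT.
    by apply/andP; split; first by rewrite adj_sym.
  - rewrite /= all_rcons pdx pdy leqnn /=; apply/andP; split.
      by move: sn => /andP[/ltnW].
    by move: sn => /andP[_]; apply: sub_all => u /ltnW.
  - rewrite pairwise_cons pairwise_rcons all_rcons sneq andbT -andbA.
    apply/and3P; split; first exact/asboolP.
      apply: sub_all sn => u un; rewrite neqC; apply: d_neq; by rewrite pdx.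
    by apply: sub_all sn => u un; apply: d_neq; rewrite pdy.
have above x y n z s : x <> y -> d x = n -> d y = n ->
    all (fun u => d u < n) (z :: s) ->
    pairwise neq (z :: s) -> pairwise neq (x :: rcons (z :: s) y).
  move=> xy dx dy sn sneq.
  rewrite pairwise_cons pairwise_rcons all_rcons sneq andbT -andbA.
  apply/and3P; split; first exact/asboolP.
    by apply: sub_all sn => u un; rewrite neqC; apply: d_neq; rewrite dx.
  by apply: sub_all sn => u un; apply: d_neq; rewrite dy.
(* Such an edge would close the path of [connect] to a cycle. *)
have no_flat u v : adj u v -> d u <> d v.
  move=> uv duv; have nuv : u <> v by move=> e; rewrite e adj_irr in uv.
  have vu : adj v u by rewrite adj_sym.
  have [z [s [ps sn sneq]]] := connect _ _ _ nuv erefl (esym duv).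
  have := above _ _ _ _ _ nuv erefl (esym duv) sn sneq.
  case: s ps {sn sneq} => [|w s] ps /(acyclic_cycle (@tree_acyclic T)) /=; apply.
    by move: ps => /=; rewrite vu => /and3P[-> -> _].
  by move: ps => /=; rewrite !rcons_path last_rcons vu => /and3P[-> -> /andP[-> ->]].
(* Otherwise [v] would close the path between its neighbours [p v] and [u] to a cycle. *)
have parent_uniq u v : adj u v -> d v = (d u).+1 -> p v = u.
  move=> uv dv; apply: contrapT => pvu; have [av dpv] := pP v _ dv.
  have vp : adj v (p v) by rewrite adj_sym.
  have [z [s [ps sn sneq]]] := connect _ _ _ pvu dpv erefl.
  have := above _ _ _ _ _ pvu dpv erefl sn sneq => cneq.
  apply: (@acyclic_cycle T v (p v) z (rcons s u) (@tree_acyclic T)).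
    rewrite rcons_cons in cneq; rewrite pairwise_cons cneq andbT.
    apply: (@sub_all _ (fun w => d w <= d u)).
      by move=> w wu; suff : neq v w by []; rewrite neqC; apply: d_neq; rewrite dv.
    rewrite /= all_rcons dpv leqnn /=; move: sn => /= /andP[/ltnW -> /=].
    by apply: sub_all => w /ltnW.
  by move: ps => /=; rewrite !rcons_path last_rcons vp uv => /and3P[-> -> ->].
exists (d, p); split=> //= u v uv.
have := d_adj _ _ uv; rewrite leq_eqVlt => /orP[/eqP dv|dv].
  by left; split=> //; exact: parent_uniq.
right; have vu : adj v u by rewrite adj_sym.
suff du : d u = (d v).+1 by split=> //; exact: parent_uniq.
apply/eqP; rewrite eqn_leq d_adj //= ltn_neqAle -ltnS dv andbT.
by apply/eqP => /esym; exact: no_flat.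
Qed.

End levels_exist.

(** * Rooted trees built from depth and parent functions *)

Section tree_of_levels.
Variables (V : Type) (r : V) (d : V -> nat) (p : V -> V).
Hypothesis d_root : d r = 0.
Hypothesis d_eq0 : forall v, d v = 0 -> v = r.
Hypothesis d_parent : forall v n, d v = n.+1 -> d (p v) = n.

Let is_edge (u v : V) : Prop :=
  d v = (d u).+1 /\ p v = u \/ d u = (d v).+1 /\ p u = v.

Let edge : rel V := fun u v => `[<is_edge u v>].

Let edge_sym : symmetric edge.
Proof.
by move=> u v; apply/idP/idP => /asboolP[h|h]; apply/asboolP; [right|left|right|left].
Qed.

Let edge_irr : irreflexive edge.
Proof. by move=> u; apply/negbTE/asboolPn => -[] [/n_Sn]. Qed.

Let levels_graph := Graph edge_sym edge_irr.

Let edge_parent v n : d v = n.+1 -> edge (p v) v.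
Proof. by move=> dv; apply/asboolP; left; rewrite (d_parent dv). Qed.

Let levels_connected : connected_graph levels_graph.
Proof.
pose conn x y := exists2 s, path edge x s & last x s = y.
have conn_trans x y z : conn x y -> conn y z -> conn x z.
  move=> [s ps sy] [t pt tz]; exists (s ++ t); last by rewrite last_cat sy.
  by rewrite cat_path ps sy.
have conn_edge x y : edge x y -> conn x y by move=> xy; exists [:: y]; rewrite //= xy.
suff conn_root v : conn r v /\ conn v r.
  by move=> x y; apply: conn_trans (conn_root x).2 (conn_root y).1.
move nE : (d v) => n; elim: n v nE => [|n IH] v dv.
  by rewrite (d_eq0 dv); split; exists [::].
have [rp pr] := IH _ (d_parent dv); have pv := edge_parent dv.
split; first exact: conn_trans rp (conn_edge _ _ pv).
by apply: conn_trans pr; apply: conn_edge; rewrite edge_sym.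
Qed.

Let ordS_ordS n (i : 'I_n.+3) : ordS (ordS i) <> i.
Proof.
move=> /(congr1 val) /= /eqP.
rewrite -[X in _ == X](modn_small (ltn_ord i)) -addn1 modnDml addn1 -addn2.
by rewrite -[X in _ == X %[mod _]]addn0 eqn_modDl.
Qed.

(** At a vertex of maximal depth on a cycle, both cyclic neighbours are its parent and so coincide,
    which is impossible in length at least 3. *)
Let levels_acyclic : acyclic_graph levels_graph.
Proof.
move=> n c cI adj_c; have [i _ imax] := @arg_maxnP _ ord0 xpredT (d \o c) isT.
have parent_i j : edge (c i) (c j) -> p (c i) = c j.
  move=> /asboolP[[dj _]|[]//]; have := imax j isT.
  by rewrite /= dj ltnn.
have next : p (c i) = c (ordS i) by apply/parent_i/adj_c.
have prev : p (c i) = c (ord_pred i).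
  by apply: parent_i; rewrite edge_sym -{2}(ord_predK i); exact: adj_c.
by apply: (@ordS_ordS n (ord_pred i)); rewrite ord_predK; apply: cI; rewrite -next.
Qed.

Definition tree_of_levels : rooted_tree :=
  @RootedTree levels_graph r levels_connected levels_acyclic.

Lemma levels_tree_of_levels : @levels tree_of_levels d p.
Proof.
split=> //= [v n dv|u v /asboolP //].
by split; [exact: edge_parent dv|exact: d_parent].
Qed.

End tree_of_levels.

(** * Embeddings of rooted trees as simulations *)

Section branches.
Variables (T : rooted_tree) (d : T -> nat) (p : T -> T).

(** The condition [0 < d w] keeps the root from being a child, whatever [p] does there. *)
Definition kid (v w : T) : Prop := 0 < d w /\ p w = v.

CoFixpoint branch (v : T) : cotree :=
  Node (fun w : {w : T | kid v w} => branch (sval w)).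

End branches.

Section maps_of_trees.
Variables (T T' : rooted_tree) (d : T -> nat) (p : T -> T).
Variables (d' : T' -> nat) (p' : T' -> T').
Hypotheses (dp : levels d p) (dp' : levels d' p').

(** Induction on depth. If the edge from [u = p v] to [v] were mapped towards the root, [f v] would
    be the parent of [f u], which is [f (p u)]; then [v = p u], against the depths. *)
Lemma embedding_levels (f : T -> T') : embedding f ->
  f (root_vertex T) = root_vertex T' ->
  forall v, d' (f v) = d v /\ (0 < d v -> p' (f v) = f (p v)).
Proof.
case: dp => dr d0 dS dA; case: dp' => dr' _ _ dA'.
move=> [fI fhom] fr v; move nE : (d v) => n; elim: n v nE => [|n IH] v dv.
  by rewrite (d0 _ dv) fr.
have [uv du] := dS _ _ dv; have [d'u p'u] := IH _ du.
case: (dA' _ _ (fhom _ _ uv)) => [[-> ->]|[d'v pfu]]; first by rewrite d'u.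
have n0 : 0 < n by rewrite -d'u d'v.
move: (p'u n0); rewrite pfu => /fI vppv; exfalso.
case: n du n0 dv {IH d'u p'u} => // n /dS[_ dppv] _.
by rewrite vppv dppv => /eqP; rewrite -[X in X == _]addn0 -addn2 eqn_add2l.
Qed.

Lemma embedding_sim (full : Prop) (f : T -> T') : embedding f ->
  f (root_vertex T) = root_vertex T' ->
  (full -> forall y, exists x, f x = y) ->
  sim full (branch d p (root_vertex T)) (branch d' p' (root_vertex T')).
Proof.
move=> femb fr fS; have fL := embedding_levels femb fr.
apply: (@sim_coind _ (fun c c' =>
    exists v, c = branch d p v /\ c' = branch d' p' (f v)));
  last by exists (root_vertex T); rewrite fr.
move=> _ _ [v [-> ->]].
have kid_f (w : {w | kid d p v w}) : kid d' p' (f v) (f (sval w)).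
  case: w => w [/= w0 <-]; have [d'w p'w] := fL w.
  by split; [rewrite d'w|exact: p'w].
exists (fun w => exist _ (f (sval w)) (kid_f w)); split.
- by move=> x y /(congr1 sval) /= /femb.1/sval_inj.
- move=> /fS{}fS [w' [w'0 pw']]; have [w wE] := fS w'.
  have [d'w p'w] := fL w; have w0 : 0 < d w by rewrite -d'w wE.
  have kw : kid d p v w by split=> //; apply: femb.1; rewrite -p'w // wE.
  by exists (exist _ w kw); apply: sval_inj.
- by move=> w; exists (sval w).
Qed.

Lemma sim_embedding (full : Prop) :
  sim full (branch d p (root_vertex T)) (branch d' p' (root_vertex T')) ->
  exists f : T -> T', [/\ embedding f, f (root_vertex T) = root_vertex T'
    & full -> forall y, exists x, f x = y].
Proof.
case: dp => dr d0 dS dA; case: dp' => dr' d0' dS' dA' root_sim.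
pose Z v v' := sim full (branch d p v) (branch d' p' v').
(* For each pair of vertices one matching of their children is fixed, extended to all of [T] by the
   junk value [x.2]. *)
have ex_step (x : T * T') : exists s : T -> T', Z x.1 x.2 ->
    [/\ forall w, kid d p x.1 w -> kid d' p' x.2 (s w) /\ Z w (s w),
        forall v w, kid d p x.1 v -> kid d p x.1 w -> s v = s w -> v = w
      & full -> forall w', kid d' p' x.2 w' -> exists2 w, kid d p x.1 w & s w = w'].
  have [/sim_unfold|nZ] := pselect (Z x.1 x.2); last by exists (fun=> x.2) => /nZ.
  move=> -[/= s [sI sS sR]].
  have ext w : exists w', forall kw : kid d p x.1 w, w' = sval (s (exist _ w kw)).
    have [kw|nkw] := pselect (kid d p x.1 w); last by exists x.2 => kw; case: (nkw kw).
    exists (sval (s (exist _ w kw))) => kw'.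
    by congr (sval (s _)); exact: sval_inj.
  have [t tE] := choice ext; exists t => _; split.
  - move=> w kw; rewrite (tE w kw); split; last exact: (sR (exist _ w kw)).
    exact: (svalP (s _)).
  - by move=> v w kv kw; rewrite (tE v kv) (tE w kw) => /sval_inj/sI [].
  - move=> /sS{}sS w' kw'; have [[w kw] sw] := sS (exist _ w' kw').
    by exists w => //; rewrite (tE w kw) sw.
have [step stepP] := choice ex_step.
(* Structural recursion on [n], which is instantiated with the depth of [v]; the image of the parent
   selects the matching to use. *)
pose F := fix F n v : T' :=
  if n is m.+1 then step (p v, F m (p v)) v else root_vertex T'.
pose f v := F (d v) v.
have f_root : f (root_vertex T) = root_vertex T' by rewrite /f dr.
have fS v n : d v = n.+1 -> f v = step (p v, f (p v)) v.
  by move=> dv; rewrite /f dv; have [_ ->] := dS _ _ dv.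
have kid_p v n : d v = n.+1 -> kid d p (p v) v by move=> dv; rewrite /kid dv.
have fZ v : Z v (f v) /\ d' (f v) = d v.
  move nE : (d v) => n; elim: n v nE => [|n IH] v dv.
    by rewrite (d0 _ dv) f_root.
  have [_ du] := dS _ _ dv; have [Zu d'u] := IH _ du.
  have [/(_ v (kid_p _ _ dv)) /= + _ _] := stepP (p v, f (p v)) Zu.
  rewrite -(fS _ _ dv) => -[[d'v p'v] Zv]; split=> //.
  case d'fv : (d' (f v)) d'v => [//|m] _.
  by have [_] := dS' _ _ d'fv; rewrite p'v d'u => ->.
have p'f v n : d v = n.+1 -> p' (f v) = f (p v).
  move=> dv; rewrite (fS _ _ dv).
  by have [/(_ v (kid_p _ _ dv)) /= [[_ ->]]] := stepP (p v, f (p v)) (fZ _).1.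
have fI : injective f.
  move=> v w; move nE : (d v) => n; elim: n v w nE => [|n IH] v w dv vw.
    have dw : d w = 0 by rewrite -(fZ w).2 -vw (fZ v).2.
    by rewrite (d0 _ dv) (d0 _ dw).
  have dw : d w = n.+1 by rewrite -(fZ w).2 -vw (fZ v).2.
  have pvw : p v = p w.
    apply: IH; first by have [] := dS _ _ dv.
    by rewrite -(p'f _ _ dv) vw (p'f _ _ dw).
  have [_ sI _] := stepP (p v, f (p v)) (fZ _).1; apply: sI.
  - exact: kid_p dv.
  - by rewrite pvw; exact: kid_p dw.
  - by rewrite -(fS _ _ dv) vw (fS _ _ dw) pvw.
have f_parent u v : d v = (d u).+1 -> p v = u -> adj (f u) (f v).
  move=> dv pv; have d'v : d' (f v) = (d u).+1 by rewrite (fZ v).2.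
  by have [+ _] := dS' _ _ d'v; rewrite (p'f _ _ dv) pv.
exists f; split=> //.
  split=> // u v /dA[[]|[]]; first exact: f_parent.
  by rewrite adj_sym; exact: f_parent.
move=> isfull v'; move nE : (d' v') => n; elim: n v' nE => [|n IH] v' dv'.
  by exists (root_vertex T); rewrite f_root (d0' _ dv').
have [_ du'] := dS' _ _ dv'; have [u fu] := IH _ du'.
have [_ _ /(_ isfull v') /=] := stepP (u, f u) (fZ _).1.
case; first by rewrite /kid dv' fu.
move=> w [w0 pw] sw; exists w; move: w0; case dw : (d w) => [//|m] _.
by rewrite (fS _ _ dw) pw.
Qed.

(** A surjective embedding also reflects edges: an edge between images joins a vertex to its parent,
    and parents correspond under [f]. *)
Lemma sim_isomorphism :
  ciso (branch d p (root_vertex T)) (branch d' p' (root_vertex T')) ->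
  exists2 f : T -> T', isomorphism f & f (root_vertex T) = root_vertex T'.
Proof.
move=> /sim_embedding[f [femb fr /(_ Logic.I) fS]]; exists f => //.
have fL := embedding_levels femb fr; have [fI fhom] := femb.
split.
  have [g fg] := choice fS; exists g => // x; apply: fI; exact: fg.
have back u v : d' (f v) = (d' (f u)).+1 -> p' (f v) = f u -> adj u v.
  rewrite !(fL _).1 => dv; rewrite (fL v).2 ?dv // => /fI <-.
  by case: dp => _ _ /(_ _ _ dv) [].
move=> u v; apply/idP/idP; last exact: fhom.
case: dp' => _ _ _ /[apply] -[[]|[]]; first exact: back.
by rewrite adj_sym; exact: back.
Qed.

End maps_of_trees.

(** * Realizing a coinductive tree as a rooted tree *)

Section positions.
Variable c : cotree.

(** The vertices at depth [n] and the subtrees below them are defined together, since the children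
    of a vertex are indexed by its subtree. *)
Fixpoint level (n : nat) : {X : Type & X -> cotree} :=
  if n is m.+1 then
    existT (fun X => X -> cotree) {x : projT1 (level m) & idx (projT2 (level m) x)}
      (fun y => br (projT2 y))
  else existT (fun X => X -> cotree) unit (fun=> c).

Definition position : Type := {n : nat & projT1 (level n)}.

Let origin : position := existT _ 0 tt.

Let parent (v : position) : position :=
  match v with
  | existT 0 x => existT _ 0 x
  | existT n.+1 x => existT _ n (projT1 x)
  end.

Let subtree (v : position) : cotree := projT2 (level (projT1 v)) (projT2 v).

Let depth : position -> nat := @projT1 _ _.

Let child (v : position) (i : idx (subtree v)) : position :=
  existT (fun n => projT1 (level n)) (projT1 v).+1 (existT _ (projT2 v) i).

Let depth_eq0 v : depth v = 0 -> v = origin.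
Proof. by case: v => [[|n] x] //= _; case: x. Qed.

Let depth_parent v n : depth v = n.+1 -> depth (parent v) = n.
Proof. by case: v => [[|m] x] //= []. Qed.

Let child_inj v : injective (@child v).
Proof.
move=> i j /(@Eqdep.EqdepTheory.inj_pair2 _ _ _ _ _).
exact: Eqdep.EqdepTheory.inj_pair2.
Qed.

Definition position_tree : rooted_tree :=
  tree_of_levels depth_eq0 depth_parent.

Lemma position_tree_sim : exists d p, @levels position_tree d p /\
  ciso (branch d p (root_vertex position_tree)) c.
Proof.
exists depth, parent; split; first exact: levels_tree_of_levels.
apply: ciso_sym.
apply: (@sim_coind _ (fun a b => exists v : position_tree,
  a = subtree v /\ b = @branch position_tree depth parent v)); last by exists origin.
move=> _ _ [v [-> ->]].
have kid_child (i : idx (subtree v)) :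
    kid (T := position_tree) depth parent v (child i).
  by split=> //=; case: v i.
exists (fun i => exist _ (child i) (kid_child i)); split.
- by move=> i j /(congr1 sval) /= /child_inj.
- move=> _ [[[|n] x] k]; first by case: (k).
  have xv : parent (existT _ n.+1 x) = v by case: (k).
  by subst v; exists (projT2 x); apply: sval_inj => /=; rewrite /child; case: (x).
- by move=> i; exists (child i).
Qed.

End positions.

(** * Transfer to rooted trees and conclusion *)

Lemma code_exists (T : rooted_tree) : exists c : cotree, exists d p,
  @levels T d p /\ c = branch d p (root_vertex T).
Proof.
have [[d p] dp] := levels_exist T.
by exists (branch d p (root_vertex T)), d, p.
Qed.

Lemma coding : exists code : rooted_tree -> cotree,
  [/\ forall T T', twins T T' <-> twin (code T) (code T'),
      forall T T', isomorphic T T' <-> ciso (code T) (code T')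
    & forall c, exists T, ciso (code T) c].
Proof.
have [code codeP] := choice code_exists; exists code; split.
- move=> T T'; have [[d [p [dp ->]]] [d' [p' [dp' ->]]]] := (codeP T, codeP T').
  split=> [[[f femb fr] [g gemb gr]]|[]].
    by split; [apply: (embedding_sim dp dp' femb)|apply: (embedding_sim dp' dp gemb)].
  move=> /(sim_embedding dp dp')[f [femb fr _]] /(sim_embedding dp' dp)[g [gemb gr _]].
  by split; [exists f|exists g].
- move=> T T'; have [[d [p [dp ->]]] [d' [p' [dp' ->]]]] := (codeP T, codeP T').
  split=> [[f [[g fK gK] fmono] fr]|]; last exact: sim_isomorphism.
  apply: (embedding_sim dp dp' (f := f)) => //.
    by split; [exact: can_inj fK|move=> x y; rewrite fmono].
  by move=> _ y; exists (g y).
- move=> c; have [d [p [dp iso_c]]] := position_tree_sim c.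
  exists (position_tree c); have [d' [p' [dp' ->]]] := codeP (position_tree c).
  (* The depth and parent functions chosen by [code] may differ from those of the construction; the
     identity map compares the two. *)
  apply: sim_trans iso_c; apply: (embedding_sim dp' dp (f := id)) => //.
    by split.
  by move=> _ y; exists y.
Qed.

Theorem theorem1 (T : rooted_tree) :
  twin_classes T #= `I_1 \/ infinite_set (twin_classes T).
Proof.
have [code [twinsE isoE decode]] := coding.
have [Trigid|Tmany] := rigid_or_many_twins (code T); [left|right].
  suff -> : twin_classes T = [set iso_class T] by exact: card_set1.
  apply/seteqP; split=> [_ [T' /twinsE/Trigid TT' <-]|_ ->]; last first.
    by exists T => //; apply/twinsE; exact: twin_refl.
  apply/seteqP; split=> T'' /isoE h; apply/isoE.
    exact: sim_trans TT' h.
  exact: sim_trans (ciso_sym TT') h.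
(* With only [n] classes, any [n.+1] twins of the code, decoded to rooted trees, would meet some
   class twice. *)
move=> [n cardT]; apply: (Tmany n) => x Tx.
have [X XP] := choice (fun i => decode (x i)).
have XT i : twins T (X i).
  apply/twinsE; apply: twin_trans (Tx i) _; exact: ciso_twin (ciso_sym (XP i)).
have [i [j [ij eij]]] : exists i j, i <> j /\ iso_class (X i) = iso_class (X j).
  apply: contrapT => nij.
  have XI : injective (iso_class \o X).
    move=> i j eij; apply: contrapT => ij; apply: nij.
    by exists i, j.
  have [f] : $|{injfun `I_n.+1 >-> twin_classes T}|.
    apply/injfunPex; exists (fun i => iso_class (X (inord i))).
      by move=> i _; exists (X (inord i)) => //; exact: XT.
    move=> i j /set_mem iN /set_mem jN /XI /(congr1 (@nat_of_ord _)).
    by rewrite !inordK.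
  have := inj_card_le f; rewrite (card_le_eqr cardT).
  by rewrite card_le_II ltnn.
exists i, j; split=> //.
have : iso_class (X j) (X j) by apply/isoE; exact: sim_refl.
rewrite -eij => /isoE Xij.
exact: sim_trans (ciso_sym (XP i)) (sim_trans Xij (XP j)).
Qed.
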